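(* Let $G$ be a strongly co-Hopfian abelian group with torsion subgroup $T$. Then $G$ is uniformly strongly co-Hopfian if and only if $T$ is strongly co-Hopfian.
   Context: All groups are abelian. A group $G$ is strongly co-Hopfian if for every endomorphism $f$ of $G$ there is $n\in\mathbb N$ with $f^n(G)=f^{n+1}(G)$. It is uniformly strongly co-Hopfian if there is a fixed $m\in\mathbb N$ such that $\phi^m(G)=\phi^{m+1}(G)$ for every endomorphism $\phi$ of $G$. *)

(* Defs.v *)
From mathcomp Require Import all_boot all_algebra.
Set Implicit Arguments. Unset Strict Implicit. Unset Printing Implicit Defensive.
Import GRing.Theory.
Local Open Scope ring_scope.

(* Abelian groups are modelled as MathComp zmodTypes (additive notation).
   A subgroup is given by a predicate S : G -> Prop. *)

Definition img (G : zmodType) (f : G -> G) (S : G -> Prop) : G -> Prop :=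
  fun x => exists2 y, S y & x = f y.

(* f restricts to an endomorphism of the subgroup S: it maps S into S
   and is additive on S.  (Endomorphisms of the group S correspond exactly
   to such maps, modulo their irrelevant values outside S.) *)
Definition endo_on (G : zmodType) (S : G -> Prop) (f : G -> G) : Prop :=
  (forall x, S x -> S (f x)) /\
  (forall x y, S x -> S y -> f (x + y) = f x + f y).

Definition same_set (G : zmodType) (A B : G -> Prop) : Prop :=
  forall x, A x <-> B x.

Definition strongly_coHopfian_on (G : zmodType) (S : G -> Prop) : Prop :=
  forall f : G -> G, endo_on S f ->
    exists n : nat, same_set (img (iter n f) S) (img (iter n.+1 f) S).

Definition uniformly_strongly_coHopfian_on (G : zmodType) (S : G -> Prop) : Prop :=
  exists m : nat, forall f : G -> G, endo_on S f ->
    same_set (img (iter m f) S) (img (iter m.+1 f) S).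

Definition whole (G : zmodType) : G -> Prop := fun _ => True.

Definition strongly_coHopfian (G : zmodType) : Prop :=
  strongly_coHopfian_on (@whole G).

Definition uniformly_strongly_coHopfian (G : zmodType) : Prop :=
  uniformly_strongly_coHopfian_on (@whole G).

Definition torsion (G : zmodType) : G -> Prop :=
  fun x => exists2 n : nat, (0 < n)%N & x *+ n = 0.

(* Main.v *)
Require Import Defs.
From mathcomp Require Import all_boot all_algebra.
From mathcomp Require Import boolp classical_sets zify.
Set Implicit Arguments. Unset Strict Implicit. Unset Printing Implicit Defensive.
Import GRing.Theory.
Local Open Scope ring_scope.

(* For each prime p, multiplication by p shows that P := p^n G is p-divisible for
   some n, and G = G[p^n] + P. An infinite independent family of elements of the
   maximal divisible subgroup A = \bigcap_p p^(n_p) G, or an infinite direct sum of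
   copies of Z/p^(i+1) meeting p^(i+1) G trivially, would give an endomorphism of G
   acting as a right shift on it, against strong co-Hopficity. Hence every G[p^r] is
   finite, A/(A \cap T) has finite rank, and each primary component T_p is a direct
   summand of G whose endomorphisms stabilise after a bounded number of steps.

   If G is uniformly strongly co-Hopfian, endomorphisms of T_p extend to G, so the
   bound for G holds on every T_p and therefore on T. Conversely, glueing for each p
   an endomorphism of T_p of maximal index shows that, when T is strongly co-Hopfian,
   one N bounds the index on all T_p. For f in End(G) one then filters G by
   T <= T + A <= G: f stabilises on T after N steps, on (T + A)/T after at most
   rank(A/(A \cap T)) steps, and on G/A after N steps, because f^n x = f^(n+1) z puts
   x - f z in Ker f^n, and on the finite groups G/P the kernels of the powers of f are
   stationary as soon as the images are. *)

(** * Subgroups, complements and extension of homomorphisms *)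

Definition subgroup (G : zmodType) (S : G -> Prop) : Prop :=
  S 0 /\ forall x y, S x -> S y -> S (x - y).

Lemma subrACA (G : zmodType) (x y a b : G) : x - y - (a - b) = (x - a) - (y - b).
Proof. by rewrite !opprB addrACA [RHS]addrACA (addrC (- y)). Qed.

Lemma subgroup_zero (G : zmodType) : subgroup (fun x : G => x = 0).
Proof. by split=> // x y -> ->; rewrite subrr. Qed.

Section Subgroups.
Variables (G : zmodType) (S : G -> Prop).
Hypothesis sS : subgroup S.

Lemma subgroup0 : S 0. Proof. by case: sS. Qed.

Lemma subgroupB x y : S x -> S y -> S (x - y).
Proof. by case: sS => _; apply. Qed.

Lemma subgroupN x : S x -> S (- x).
Proof. by rewrite -sub0r; apply: subgroupB subgroup0. Qed.

Lemma subgroupD x y : S x -> S y -> S (x + y).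
Proof. by move=> Sx Sy; rewrite -[y]opprK; apply/subgroupB/subgroupN. Qed.

Lemma subgroup_sum (I : Type) (r : seq I) (P : pred I) (F : I -> G) :
  (forall i, P i -> S (F i)) -> S (\sum_(i <- r | P i) F i).
Proof. by move=> SF; elim/big_ind: _ => //; [exact: subgroup0|exact: subgroupD]. Qed.

Lemma subgroupMn x n : S x -> S (x *+ n).
Proof.
move=> Sx; elim: n => [|n IH]; first exact: subgroup0.
by rewrite mulrS; apply: subgroupD.
Qed.

Lemma subgroupMz x (m : int) : S x -> S (x *~ m).
Proof. by case: m => n Sx; [|apply: subgroupN]; apply: subgroupMn. Qed.

Lemma subgroup_addl x y : S x -> S (x + y) -> S y.
Proof. by move=> Sx Sxy; rewrite -[y](addKr x) addrC; apply: subgroupB. Qed.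

Lemma subgroup_coprime (m : nat) (k : int) x :
  coprimez m k -> S (x *+ m) -> S (x *~ k) -> S x.
Proof.
move=> cop Sm Sk; have [u [v Euv]] := Bezoutz m k.
move/eqP: cop => cop; rewrite cop in Euv.
rewrite -[x]mulr1z -Euv mulrzDr (mulrC u) (mulrC v) !mulrzA.
by apply: subgroupD; apply: subgroupMz.
Qed.

End Subgroups.

(** Prime factors of [n] are removed one at a time. [S] is an arbitrary predicate, so that
    [torsion_pi0] can take an implication for it. *)
Lemma subgroup_pure (G : zmodType) (S : G -> Prop) :
  (forall (q : nat) x, prime q -> S (x *+ q) -> S x) ->
  forall (n : nat) x, (0 < n)%N -> S (x *+ n) -> S x.
Proof.
move=> Sq; elim/ltn_ind => n IH x n0 Sx.
have [n1|n1] := leqP n 1.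
  by move: Sx; have -> : n = 1%N by lia.
have pq := pdiv_prime n1; have dq := pdiv_dvd n.
move: Sx; rewrite -(divnK dq) mulrnA => /(Sq _ _ pq).
apply: IH; first exact: ltn_Pdiv (prime_gt1 pq) n0.
by rewrite divn_gt0 ?prime_gt0 // dvdn_leq.
Qed.

Lemma coprimez_prime (q : nat) (m : int) :
  prime q -> ~ (q %| m)%Z -> coprimez q m.
Proof. by move=> pq /negP nq; rewrite coprimezE prime_coprime // -dvdzE. Qed.

(** Zorn's lemma. For [x] outside a maximal [C], the larger subgroup C + Zx meets [B] outside 0,
    which is the last clause. *)
Lemma maximal_disjoint (G : zmodType) (B K : G -> Prop) :
  subgroup K -> (forall x, K x -> B x -> x = 0) ->
  exists C : G -> Prop, [/\ subgroup C, forall x, K x -> C x,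
    forall x, C x -> B x -> x = 0 &
    forall x, ~ C x -> exists (m : int) (c : G),
      [/\ C c, B (x *~ m + c) & x *~ m + c <> 0]].
Proof.
move=> sK dK.
(* [K] is joined to every set, so that the union of the empty chain is admissible too. *)
pose U (X : set G) : G -> Prop := fun x => K x \/ X x.
pose good (X : set G) := subgroup (U X) /\ forall x, U X x -> B x -> x = 0.
have [F Fgood Ftot|A [[sA dA] maxA]] := @Zorn_bigcup G good.
  split; last first.
    move=> x [Kx|[X FX Xx]] Bx; first exact: dK.
    by have [_ dX] := Fgood _ FX; apply: dX => //; right.
  split; first by left; apply: subgroup0.
  have sub X x y : F X -> U X x -> U X y -> U (\bigcup_(X in F) X)%classic (x - y).
    move=> FX Ux Uy; have [sX _] := Fgood _ FX.
    by case: (subgroupB sX Ux Uy) => h; [left|right; exists X].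
  move=> x y [Kx|[X FX Xx]] [Ky|[Y FY Yy]].
  - by left; apply: subgroupB.
  - by apply: (sub Y) => //; [left|right].
  - by apply: (sub X) => //; [right|left].
  - by case: (Ftot _ _ FX FY) => XY; [apply: (sub Y)|apply: (sub X)] => //;
      right => //; apply: XY.
exists (U A); split=> // [x Kx|x nUx]; first by left.
pose X : set G := fun y => exists (m : int) (c : G), U A c /\ y = x *~ m + c.
have AX c : U A c -> X c by exists 0, c; rewrite mulr0z add0r.
have UX y : U X y -> X y by case=> // Ky; apply: AX; left.
have nX : ~ good X.
  apply: maxA; split=> [y Ay|XA]; first by apply: AX; right.
  apply: nUx; right; apply: XA; exists 1, 0.
  by split; [exact: subgroup0|rewrite mulr1z addr0].
have sX : subgroup (U X).
  split; first by right; apply: AX; apply: subgroup0.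
  move=> y z /UX[m [c [Uc ->]]] /UX[m' [c' [Uc' ->]]]; right.
  exists (m - m'), (c - c'); split; first exact: subgroupB.
  by rewrite mulrzBr opprD addrACA.
apply: contrapT => nex; apply: nX; split=> // y /UX[m [c [Uc Ey]]] By.
apply: contrapT => y0; apply: nex; exists m, c; split=> //; rewrite -Ey //.
Qed.

(** For a maximal [C], the quotient G/(B + C) is torsion by maximality, and the condition on prime
    multiples makes it torsion-free; so B + C = G. The condition ranges over all candidates because
    the maximal [C] is not known in advance. *)
Lemma complement_exists (G : zmodType) (B K : G -> Prop) :
  subgroup B -> subgroup K -> (forall x, K x -> B x -> x = 0) ->
  (forall C : G -> Prop, subgroup C -> (forall x, K x -> C x) ->
    (forall x, C x -> B x -> x = 0) ->
    forall (q : nat) x b c, prime q -> B b -> C c -> x *+ q = b + c ->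
    exists2 b', B b' & b = b' *+ q) ->
  exists C : G -> Prop, [/\ subgroup C, forall x, K x -> C x,
    forall x, C x -> B x -> x = 0 & forall x, exists2 b, B b & C (x - b)].
Proof.
move=> sB sK dK cond; have [C [sC KC dC maxC]] := maximal_disjoint sK dK.
exists C; split=> //.
pose H x := exists2 b, B b & C (x - b).
have BH b : B b -> H b by exists b; rewrite ?subrr //; apply: subgroup0.
have CH c : C c -> H c by exists 0; rewrite ?subr0 //; apply: subgroup0.
have sH : subgroup H.
  split; first by apply: BH; apply: subgroup0.
  move=> x y [b Bb Cx] [b' Bb' Cy]; exists (b - b'); first exact: subgroupB.
  rewrite subrACA.
  exact: subgroupB.
have Hmax x m c : C c -> B (x *~ m + c) -> H (x *~ m).
  move=> Cc Bxc; rewrite -[x *~ m](addrK c).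
  by apply: subgroupB => //; [exact: BH|exact: CH].
have Hq (q : nat) x : prime q -> H (x *+ q) -> H x.
  move=> pq [b Bb Cx]; have [|b' Bb' Eb] := cond _ sC KC dC q x b _ pq Bb Cx.
    by rewrite addrC subrK.
  rewrite -[x](subrK b'); apply: subgroupD => //; last exact: BH.
  have Cx' : C ((x - b') *+ q) by rewrite mulrnBl -Eb.
  have [/CH //|nC] := pselect (C (x - b')).
  have [m [c [Cc Bxc nz]]] := maxC _ nC.
  (* Both [q] and [m] carry [x - b'] into [H]. They are coprime: if [q] divided [m], the nonzero
     element m(x - b') + c would lie in [C] and in [B]. *)
  apply: (subgroup_coprime sH (m := q) (k := m)); last exact: Hmax Bxc.
    apply: coprimez_prime => // /dvdzP[k Em]; apply: nz; apply: dC => //.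
    by apply: subgroupD => //; rewrite Em mulrC mulrzA; apply: subgroupMz.
  exact: CH.
move=> x; have [/CH //|nC] := pselect (C x).
have [m [c [Cc Bxc nz]]] := maxC _ nC.
have Hm := Hmax _ _ _ Cc Bxc.
have m0 : (0 < `|m|)%N.
  rewrite absz_gt0; apply/eqP => m0; apply: nz.
  by rewrite m0 mulr0z add0r in Bxc *; apply: dC.
apply: (subgroup_pure Hq m0).
by case: (m) Hm => n //= Hm; rewrite -[_ *+ _]opprK; apply: subgroupN.
Qed.

(** Stated for primes, where it is easiest to check; [divisible_mulrn] and [divisible_mulrz] pass to
    nonzero integers. *)
Definition divisible_on (G : zmodType) (E : G -> Prop) : Prop :=
  forall (q : nat) x, prime q -> E x -> exists2 y, E y & x = y *+ q.

(** A relation closed under differences is single-valued once 0 is related to 0 alone; choice turns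
    it into a function. *)
Lemma graph_fun (G : zmodType) (R : G -> G -> Prop) :
  (forall x, exists y, R x y) -> (forall y, R 0 y -> y = 0) ->
  (forall x y x' y', R x y -> R x' y' -> R (x - x') (y - y')) ->
  exists f : G -> G, (forall x y, f (x + y) = f x + f y) /\
    (forall x y, R x y -> f x = y).
Proof.
move=> Rtot R0 RB; have [f Rf] := choice Rtot; exists f.
have funR x y : R x y -> f x = y.
  move=> Rxy; apply/eqP; rewrite -subr_eq0; apply/eqP/R0.
  by rewrite -[0](subrr x); apply: RB.
split=> // x y; apply: funR.
have R00 : R 0 0 by have := RB _ _ _ _ (Rf 0) (Rf 0); rewrite !subrr.
have RN := RB _ _ _ _ R00 (Rf y); rewrite !sub0r in RN.
by have := RB _ _ _ _ (Rf x) RN; rewrite !opprK.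
Qed.

(* Injectivity of divisible groups: a complement of [0 * E] in [G * G] containing the
   graph [R] is the graph of the extension. *)
Lemma extend_to_divisible (G : zmodType) (E : G -> Prop) (R : G -> G -> Prop) :
  subgroup E -> divisible_on E ->
  R 0 0 -> (forall y, R 0 y -> y = 0) ->
  (forall x y x' y', R x y -> R x' y' -> R (x - x') (y - y')) ->
  (forall x y, R x y -> E y) ->
  exists f : G -> G, [/\ forall x y, f (x + y) = f x + f y,
    forall x y, R x y -> f x = y & forall x, E (f x)].
Proof.
move=> sE dE R00 R0 RB RE.
pose B (z : G * G) := z.1 = 0 /\ E z.2.
pose K (z : G * G) := R z.1 z.2.
have sB : subgroup B.
  split; first by split; last exact: subgroup0.
  move=> [x y] [x' y'] [/= -> Ey] [/= -> Ey'].
  by split; rewrite /= ?subrr //; apply: subgroupB.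
have sK : subgroup K by split=> // -[x y] [x' y']; apply: RB.
have [||C [sC KC dC totC]] := complement_exists sB sK.
- by move=> [x y] /= Kx [/= x0 _]; rewrite /K /= x0 in Kx *; rewrite (R0 _ Kx).
- move=> C sC KC dC q x [b1 b] c pq [/= -> Eb] Cc Ex.
  have [e Ee ->] := dE q b pq Eb; exists (0, e) => //.
  have pairMn n : (0, e) *+ n = (0, e *+ n) :> G * G.
    by elim: n => // n IH; rewrite !mulrS IH; congr pair; rewrite /= addr0.
  by rewrite pairMn.
have [|y|x y x' y' [Ey Cy] [Ey' Cy']|f [fD fR]] :=
    @graph_fun G (fun x y => E y /\ C (x, y)).
(* Subtracting (0, b) moves (x, 0) into [C], so [x] is sent to [- b]. *)
- move=> x; have [[b1 b] [/= -> Eb] Cx] := totC (x, 0).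
  exists (- b); split; first exact: subgroupN.
  by move: Cx; congr C; congr pair => /=; rewrite ?subr0 ?sub0r.
- by move=> [Ey Cy]; exact: (congr1 snd (dC _ Cy (conj erefl Ey))).
- split; first exact: subgroupB.
  exact: (subgroupB sC Cy Cy').
exists f; split=> // [x y Rxy|x].
  by apply: fR; split; [exact: RE Rxy|exact: (KC (x, y))].
have [[b1 b] [/= -> Eb] Cx] := totC (x, 0).
rewrite (fR x (- b)) //; first exact: subgroupN.
split; first exact: subgroupN.
by move: Cx; congr C; congr pair => /=; rewrite ?subr0 ?sub0r.
Qed.

(** * Endomorphisms and independent families *)

(** Only the inclusion of f^n(S) in f^(n+1)(S) is recorded; for endomorphisms the reverse one is
    automatic, see [same_imgP]. *)
Definition stable_at (G : zmodType) (S : G -> Prop) (f : G -> G) (n : nat) : Prop :=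
  forall x, S x -> img (iter n.+1 f) S (iter n f x).

Section Endomorphisms.
Variables (G : zmodType) (S : G -> Prop) (f : G -> G).
Hypotheses (sS : subgroup S) (ef : endo_on S f).

Lemma endo_closed x : S x -> S (f x). Proof. by case: ef => h _; apply: h. Qed.

Lemma endoD x y : S x -> S y -> f (x + y) = f x + f y.
Proof. by case: ef => _ h; apply: h. Qed.

Lemma endo0 : f 0 = 0.
Proof.
have S0 := subgroup0 sS.
by apply: (addrI (f 0)); rewrite -endoD // !addr0.
Qed.

Lemma endoN x : S x -> f (- x) = - f x.
Proof.
move=> Sx; apply: (addrI (f x)); rewrite -endoD //; last exact: subgroupN.
by rewrite !subrr endo0.
Qed.

Lemma endoB x y : S x -> S y -> f (x - y) = f x - f y.
Proof. by move=> Sx Sy; rewrite endoD ?endoN //; apply: subgroupN. Qed.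

Lemma endoMn x n : S x -> f (x *+ n) = f x *+ n.
Proof.
move=> Sx; elim: n => [|n IH]; first exact: endo0.
by rewrite !mulrS endoD ?IH //; apply: subgroupMn.
Qed.

Lemma endoMz x (m : int) : S x -> f (x *~ m) = f x *~ m.
Proof.
by case: m => n Sx; [|rewrite !NegzE !mulrNz endoN; first congr (- _)];
  try exact: endoMn; apply: subgroupMn.
Qed.

Lemma endo_sum (I : Type) (r : seq I) (P : pred I) (F : I -> G) :
  (forall i, P i -> S (F i)) ->
  f (\sum_(i <- r | P i) F i) = \sum_(i <- r | P i) f (F i).
Proof.
move=> SF; elim: r => [|i r IH]; first by rewrite !big_nil endo0.
rewrite !big_cons; case: ifP => // Pi.
by rewrite endoD ?IH //; [exact: SF|apply: subgroup_sum].
Qed.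

Lemma endo_iter n : endo_on S (iter n f).
Proof.
elim: n => [|n [cl add]]; first by split.
split=> [x Sx|x y Sx Sy]; rewrite !iterS; first exact/endo_closed/cl.
by rewrite add // endoD //; apply: cl.
Qed.

Lemma img_subgroup : subgroup (img f S).
Proof.
split; first by exists 0; [exact: subgroup0|rewrite endo0].
by move=> _ _ [x Sx ->] [y Sy ->]; exists (x - y); rewrite ?endoB //; apply: subgroupB.
Qed.

Lemma img_iter_add i j x : img (iter (i + j) f) S x -> img (iter i f) S x.
Proof.
move=> [y Sy ->]; exists (iter j f y); last by rewrite -iterD.
by have [cl _] := endo_iter j; apply: cl.
Qed.

Lemma img_stable n : stable_at S f n ->
  forall k x, S x -> img (iter (n + k) f) S (iter n f x).
Proof.
move=> st; elim=> [|k IH] x Sx; first by rewrite addn0; exists x.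
have [y Sy ->] := IH _ Sx; have [z Sz Ez] := st _ Sy.
exists z => //; rewrite addnC iterD Ez -iterD; congr iter; lia.
Qed.

Lemma img_stable_le n m : (n <= m)%N -> stable_at S f n -> stable_at S f m.
Proof.
move=> nm st x Sx; have [y Sy E] := st _ Sx; exists y => //.
by rewrite -(subnK nm) iterD E -iterD addnS.
Qed.

Lemma same_imgP n : same_set (img (iter n f) S) (img (iter n.+1 f) S) <->
  stable_at S f n.
Proof.
split=> [same x Sx|st x]; first by apply/same; exists x.
split=> [[y Sy ->]|]; first exact: st.
by rewrite -addn1; apply: img_iter_add.
Qed.

End Endomorphisms.

Lemma subgroup_whole (G : zmodType) : subgroup (@whole G). Proof. by []. Qed.

Lemma endo_whole (G : zmodType) (f : G -> G) :
  (forall x y, f (x + y) = f x + f y) -> endo_on (@whole G) f.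
Proof. by move=> fD; split=> // x y _ _. Qed.

Lemma endo_on_sub (G : zmodType) (S S' : G -> Prop) (f : G -> G) :
  endo_on S f -> (forall x, S' x -> S x) -> (forall x, S' x -> S' (f x)) ->
  endo_on S' f.
Proof. by move=> [_ fD] sub cl; split=> // x y /sub Sx /sub Sy; apply: fD. Qed.

Definition comb (G : zmodType) (s : nat -> G) (c : nat -> int) (M : nat) : G :=
  \sum_(i < M) s i *~ c i.

Lemma comb_eq (G : zmodType) (s : nat -> G) c c' M :
  (forall i, (i < M)%N -> c i = c' i) -> comb s c M = comb s c' M.
Proof. by move=> E; apply: eq_bigr => i _; rewrite E. Qed.

Lemma comb_pad (G : zmodType) (s : nat -> G) c M M' : (M <= M')%N ->
  comb s c M = comb s (fun i => if (i < M)%N then c i else 0) M'.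
Proof.
move=> MM'; rewrite /comb (big_ord_widen _ (fun i => s i *~ c i) MM') big_mkcond.
by apply: eq_bigr => i _; case: ifP; rewrite ?mulr0z.
Qed.

(** The coefficients are chosen before the sequence, because [shift_graphB] needs the same ones for
    [s] and for its shift. *)
Lemma comb_sub c c' M M' : exists c'' M'',
  forall (G : zmodType) (s : nat -> G),
    comb s c M - comb s c' M' = comb s c'' M''.
Proof.
exists (fun i => (if (i < M)%N then c i else 0) - (if (i < M')%N then c' i else 0)).
exists (maxn M M') => G s.
rewrite (comb_pad s c (leq_maxl M M')) (comb_pad s c' (leq_maxr M M')) /comb -sumrB.
by apply: eq_bigr => i _; rewrite mulrzBr.
Qed.

Lemma combMz (G : zmodType) (s : nat -> G) c M m :
  comb s c M *~ m = comb s (fun i => c i * m) M.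
Proof.
by rewrite /comb mulrz_suml; apply: eq_bigr => i _; rewrite mulrzA.
Qed.

Lemma comb_delta (G : zmodType) (s : nat -> G) n m :
  comb s (fun i => if i == n then m else 0) n.+1 = s n *~ m.
Proof.
rewrite /comb big_ord_recr /= eqxx big1 ?add0r // => i _.
by rewrite ltn_eqF ?mulr0z.
Qed.

(* The relations of a basis of a direct sum of copies of [Z/d]; [d = 0] means freeness. *)
Definition independent (G : zmodType) (d : nat) (s : nat -> G) : Prop :=
  forall c M, comb s c M = 0 <-> forall i, (i < M)%N -> (d %| c i)%Z.

(** If the images of [f] stabilise at n, then s_n = f^(n+1)(x), and some m x is a nonzero
    combination of [s] plus an element of [K]. Applying f^(n+1) turns m s_n into the same
    combination of terms beyond s_n. By independence [d] divides all its coefficients, so the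
    combination was zero. *)
Lemma no_shift (G : zmodType) (s : nat -> G) (d : nat) (K : G -> Prop) (f : G -> G) :
  strongly_coHopfian G -> d <> 1%N -> independent d s ->
  (forall x, ~ K x -> exists m c M k,
    [/\ K k, comb s c M <> 0 & x *~ m = comb s c M + k]) ->
  (forall x y, f (x + y) = f x + f y) ->
  (forall i, f (s i) = s i.+1) -> (forall k, K k -> f k = 0) -> False.
Proof.
move=> SCH d1 ind ess fD fs fK.
have ef := endo_whole fD; have sW := subgroup_whole G.
have [n /(same_imgP ef) st] := SCH f ef.
have fsi k i : iter k f (s i) = s (i + k)%N.
  by elim: k => [|k IH]; rewrite ?addn0 // iterS IH fs addnS.
have [//|x _] := st (s 0%N); rewrite fsi add0n => Ex.
have sn0 : s n <> 0.
  rewrite -[s n]mulr1z -(comb_delta s n) => /ind/(_ n (ltnSn n)).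
  by rewrite eqxx dvdz1 => /eqP /d1.
have efn := endo_iter ef n.+1.
have nK : ~ K x.
  by move=> /fK fx0; apply: sn0; rewrite Ex iterSr fx0 (endo0 sW (endo_iter ef n)).
have [m [c [M [k [Kk c0 Emx]]]]] := ess x nK.
have fk : iter n.+1 f k = 0 by rewrite iterSr fK // (endo0 sW (endo_iter ef n)).
have Es : s n *~ m = comb (fun i => s (i + n.+1)%N) c M.
  rewrite Ex -(endoMz sW efn) // Emx (endoD efn) // fk addr0 (endo_sum sW efn) //.
  by apply: eq_bigr => i _; rewrite (endoMz sW efn) // fsi.
(* The relation between s_n and later terms: [- m] at [n], the coefficients [c] moved up by n + 1,
   zero below [n]. *)
pose c' i := if (i < n)%N then 0 else if i == n then - m else c (i - n.+1)%N.
have /ind dc : comb s c' (n.+1 + M) = 0.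
  rewrite /comb big_split_ord /= big_ord_recr /= big1 => [|i _]; last first.
    by rewrite /c' ltn_ord mulr0z.
  rewrite add0r /c' ltnn eqxx mulrNz Es addrC; apply/eqP; rewrite subr_eq0.
  apply/eqP/eq_bigr => i _; rewrite addnC.
  by have -> : (i + n.+1 < n)%N = false; [lia|]; rewrite gtn_eqF ?addnK; [|lia].
apply: c0; apply/ind => i iM; have := dc (i + n.+1)%N.
rewrite /c' addnK.
have -> : (i + n.+1 < n)%N = false by lia.
by rewrite gtn_eqF; [apply; lia|lia].
Qed.

(** * Shift endomorphisms *)

Definition span (G : zmodType) (s : nat -> G) (x : G) : Prop :=
  exists c M, x = comb s c M.

Lemma subgroup_span (G : zmodType) (s : nat -> G) : subgroup (span s).
Proof.
split; first by exists (fun=> 0), 0%N; rewrite /comb big_ord0.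
move=> _ _ [c [M ->]] [c' [M' ->]]; have [c'' [M'' E]] := comb_sub c c' M M'.
by exists c'', M''; rewrite E.
Qed.

Lemma independent_mulz0 (G : zmodType) (d : nat) (s : nat -> G) i (m : int) :
  independent d s -> (d %| m)%Z -> s i *~ m = 0.
Proof.
by move=> ind dm; rewrite -comb_delta; apply/ind => j _; case: eqP; rewrite ?dvdz0.
Qed.

(** The shift on span(s) + C that kills [C]. It is a relation because the coefficients are
    determined only modulo [d]. *)
Definition shift_graph (G : zmodType) (s : nat -> G) (C : G -> Prop) (x y : G) : Prop :=
  exists c M k, [/\ C k, x = comb s c M + k & y = comb (fun i => s i.+1) c M].

Section ShiftGraph.
Variables (G : zmodType) (d : nat) (s : nat -> G) (C : G -> Prop).
Hypotheses (ind : independent d s) (sC : subgroup C).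
Hypothesis dC : forall x, C x -> span s x -> x = 0.

Lemma shift_graph_kernel k : C k -> shift_graph s C k 0.
Proof.
move=> Ck; exists (fun=> 0), 0%N, k.
by rewrite /comb !big_ord0 add0r.
Qed.

Lemma shift_graph_shift i : shift_graph s C (s i) (s i.+1).
Proof.
exists (fun j => if j == i then 1 else 0), i.+1, 0; split; first exact: subgroup0.
  by rewrite comb_delta addr0.
by rewrite (comb_delta (fun j => s j.+1)).
Qed.

(** The combination lies in [C] and in the span, so it vanishes; then [d] divides its coefficients
    and the shifted combination vanishes too. *)
Lemma shift_graph0 y : shift_graph s C 0 y -> y = 0.
Proof.
move=> [c [M [k [Ck E ->]]]].
have /ind dc : comb s c M = 0.
  apply: dC; last by exists c, M.
  by rewrite -[comb _ _ _](addrK k) -E sub0r; apply: subgroupN.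
by apply: big1 => i _; apply: independent_mulz0 ind _; apply: dc.
Qed.

Lemma shift_graphB x y x' y' : shift_graph s C x y -> shift_graph s C x' y' ->
  shift_graph s C (x - x') (y - y').
Proof.
move=> [c [M [k [Ck -> ->]]]] [c' [M' [k' [Ck' -> ->]]]].
have [c'' [M'' E]] := comb_sub c c' M M'; exists c'', M'', (k - k').
by split; [exact: subgroupB|rewrite -E opprD addrACA|rewrite E].
Qed.

End ShiftGraph.

(** The shift on span(s) + C has values in the divisible group [E], hence extends to G. Maximality
    of [C] supplies the essentiality hypothesis of [no_shift]. *)
Lemma no_independent_in_divisible (G : zmodType) (E : G -> Prop) d (s : nat -> G) :
  strongly_coHopfian G -> subgroup E -> divisible_on E ->
  d <> 1%N -> independent d s -> (forall i, E (s i)) -> False.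
Proof.
move=> SCH sE dE d1 ind Es.
have [||C [sC _ dC maxC]] := @maximal_disjoint G (span s) (fun x => x = 0).
- exact: subgroup_zero.
- by [].
have [f [fD fR fE]] : exists f : G -> G, [/\ forall x y, f (x + y) = f x + f y,
    forall x y, shift_graph s C x y -> f x = y & forall x, E (f x)].
  apply: extend_to_divisible => //.
  - by apply: shift_graph_kernel; apply: subgroup0.
  - by move=> y; apply: shift_graph0 ind sC dC _.
  - by move=> x y x' y'; apply: shift_graphB.
  - move=> x _ [c [M [k [_ _ ->]]]]; apply: subgroup_sum => // i _.
    exact: subgroupMz.
apply: (no_shift (K := C) (f := f) SCH d1 ind) => // [x nC|i|k Ck].
- have [m [c [Cc [c' [M E']] nz]]] := maxC x nC.
  exists m, c', M, (- c); rewrite -E' addrK; split=> //; exact: subgroupN.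
- by apply: fR; apply: shift_graph_shift.
- by apply: fR; apply: shift_graph_kernel.
Qed.

Definition multiples (G : zmodType) (k : nat) (x : G) : Prop := exists y, x = y *+ k.

Lemma subgroup_multiples (G : zmodType) k : subgroup (@multiples G k).
Proof.
split; first by exists 0; rewrite mul0rn.
by move=> _ _ [x ->] [y ->]; exists (x - y); rewrite mulrnBl.
Qed.

Lemma multiples_coprime (G : zmodType) a b (x : G) :
  coprime a b -> multiples a (x *+ b) -> multiples a x.
Proof.
move=> cop mx; apply: (subgroup_coprime (@subgroup_multiples G a) (m := a) (k := b)) => //.
by exists x.
Qed.

Lemma divide_coprime (G : zmodType) a b (x : G) : coprime a b -> x *+ b = 0 ->
  exists m : int, x = (x *~ m) *+ a.
Proof.
move=> cop x0; have [u [v Euv]] := Bezoutz a b; exists u.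
have {}cop : gcdz a b = 1 by apply/eqP; rewrite -/(coprimez a b) coprimezE.
rewrite -[LHS]mulr1z -cop -Euv mulrzDr (mulrC v) (mulrzA _ _ v) -pmulrn x0 mul0rz.
by rewrite addr0 mulrzA -pmulrn.
Qed.

(** The span is a direct sum of copies of Z/p^(i+1) avoiding p^(i+1) G, hence a direct summand; the
    shift, zero on a complement, is defined on all of G. *)
Lemma no_independent_homogeneous (G : zmodType) (p i : nat) (s : nat -> G) :
  strongly_coHopfian G -> prime p -> independent (p ^ i.+1) s ->
  (forall c M, multiples (p ^ i.+1) (comb s c M) -> comb s c M = 0) -> False.
Proof.
move=> SCH pp ind pure.
have sB := subgroup_span s; have sK := @subgroup_multiples G (p ^ i.+1).
have [||C [sC KC dC totC]] := complement_exists sB sK.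
- by move=> x mx [c [M Ex]]; rewrite Ex in mx *; apply: pure.
- move=> C sC KC dC q x b c pq Bb Cc Ex.
  have [b0 [M Eb]] := Bb.
  (* For q different from p, [q] is invertible on [b], which is killed by p^(i+1). For q = p,
     multiplying by p^i puts p^i b in [C] and in the span, so p^i b = 0 and [p] divides the
     coefficients of [b]. *)
  have [Eqp|nqp] := eqVneq q p; last first.
    have [||m Em] := @divide_coprime G q (p ^ i.+1) b; last first.
    + by exists (b *~ m) => //; apply: subgroupMz.
    + rewrite Eb pmulrn combMz; apply/ind => j _; exact: dvdz_mull.
    by rewrite coprimeXr // prime_coprime // dvdn_prime2.
  subst q; have : b *+ p ^ i = 0.
    apply: dC; last exact: subgroupMn.
    apply: (subgroup_addl sC (x := c *+ p ^ i)); first exact: subgroupMn.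
    rewrite addrC -mulrnDl -Ex -mulrnA -expnS; apply: KC; by exists x.
  rewrite Eb pmulrn combMz => /ind dc.
  exists (comb s (fun j => (b0 j %/ p)%Z) M); first by eexists; eexists.
  rewrite pmulrn combMz; apply: comb_eq => j jM; rewrite divzK //.
  have := dc j jM; rewrite expnS PoszM dvdz_mul2r //.
  by rewrite -lt0n expn_gt0 prime_gt0.
have [x|||f [fD fR]] := @graph_fun G (shift_graph s C).
- have [b [c [M Eb]] Cx] := totC x.
  by eexists; exists c, M, (x - b); split=> //; rewrite -Eb addrC subrK.
- by move=> y; apply: shift_graph0 ind sC dC _.
- by move=> *; apply: shift_graphB.
apply: (no_shift (K := C) (f := f) SCH _ ind) => // [|x nC|j|k Ck].
- by apply/eqP; rewrite gtn_eqF // -(exp1n i.+1) ltn_exp2r // prime_gt1.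
- have [b [c [M Eb]] Cx] := totC x; exists 1, c, M, (x - b).
  rewrite -Eb mulr1z [b + _]addrC subrK; split=> // b0.
  by apply: nC; rewrite b0 subr0 in Cx.
- by apply: fR; apply: shift_graph_shift.
- by apply: fR; apply: shift_graph_kernel.
Qed.

(** * Greedy sequences and the relations among their terms *)

(** With a notion of span for [Cl], this is the dichotomy between finite rank and an infinite
    independent sequence, obtained by picking a new element as long as one exists. *)
Lemma exhaust_or_sequence (G : zmodType) (X : G -> Prop) (Cl : seq G -> G -> Prop) :
  (exists l, (forall x, x \in l -> X x) /\ forall x, X x -> Cl l x) \/
  (exists s : nat -> G, forall j, X (s j) /\ ~ Cl (mkseq s j) (s j)).
Proof.
have [|nex] := pselect (exists l, (forall x, x \in l -> X x) /\ forall x, X x -> Cl l x);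
  [by left|right].
have /choice[next nextP] : forall l, exists y, (forall x, x \in l -> X x) ->
    X y /\ ~ Cl l y.
  move=> l; have [lX|nlX] := pselect (forall x, x \in l -> X x).
    apply: contrapT => no; apply: nex; exists l; split=> // x Xx.
    by apply: contrapT => nCl; apply: no; exists x.
  by exists 0 => lX.
pose fix pre n := if n is m.+1 then rcons (pre m) (next (pre m)) else [::].
have preX n x : x \in pre n -> X x.
  elim: n x => //= n IH x; rewrite mem_rcons inE => /orP[/eqP->|/IH //].
  by have [] := nextP _ IH.
exists (fun j => next (pre j)) => j.
have -> : mkseq (fun j => next (pre j)) j = pre j.
  by elim: j => // j IH; rewrite mkseqS IH.
exact: nextP (preX j).
Qed.

Definition seq_span (G : zmodType) (l : seq G) (x : G) : Prop :=
  exists c, x = comb (nth 0 l) c (size l).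

Lemma seq_span_mkseq (G : zmodType) (s : nat -> G) j c :
  seq_span (mkseq s j) (comb s c j).
Proof.
exists c; rewrite size_mkseq; apply: eq_bigr => i _; by rewrite nth_mkseq.
Qed.

(** A last coefficient prime to [p] could be inverted, expressing the last term by earlier ones
    modulo [Y]. So [p] divides it, its term vanishes, and induction applies. *)
Lemma relation_mod_prime (G : zmodType) (p : nat) (Y : G -> Prop) (s : nat -> G) :
  prime p -> subgroup Y -> (forall i, s i *+ p = 0) ->
  (forall j c, ~ Y (s j - comb s c j)) ->
  forall M c, Y (comb s c M) -> forall i, (i < M)%N -> (p %| c i)%Z.
Proof.
move=> pp sY sp nY; elim=> // M IH c YM i.
have pc : (p %| c M)%Z.
  apply: contrapT => /(coprimez_prime pp)/eqP cop.
  have [u [v Euv]] := Bezoutz p (c M); rewrite cop in Euv.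
  apply: (nY M (fun i => c i * - v)); rewrite -combMz.
  have := subgroupMz sY v YM; congr Y.
  rewrite /comb big_ord_recr /= mulrzDl mulrNz opprK addrC -mulrzA.
  rewrite -[s M in RHS]mulr1z -Euv mulrzDr (mulrC u) (mulrzA _ _ u) -pmulrn sp.
  by rewrite mul0rz add0r (mulrC v).
rewrite ltnS leq_eqVlt => /orP[/eqP->//|]; apply: IH.
move: YM; rewrite /comb big_ord_recr /=; congr Y.
have /dvdzP[k ->] := pc.
by rewrite mulrC mulrzA -pmulrn sp mul0rz addr0.
Qed.

Lemma relation_mod_torsion (G : zmodType) (s : nat -> G) :
  (forall j n c, (0 < n)%N -> ~ torsion (s j *+ n - comb s c j)) ->
  forall M c, torsion (comb s c M) -> forall i, (i < M)%N -> c i = 0.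
Proof.
move=> nT; elim=> // M IH c [n n0 En] i.
have cM : c M = 0.
  apply/eqP; apply: contrapT => /negP cM0.
  (* The sign of [c M], since [nT] speaks of natural multiples of the last term. *)
  pose e : int := if 0 <= c M then 1 else -1.
  apply: (nT M `|c M|%N (fun i => c i * - e)); first by rewrite absz_gt0.
  exists n => //; rewrite -combMz (pmulrn (s M)).
  have -> : `|c M|%N = c M * e :> int by rewrite /e; case: ifP; lia.
  rewrite mulrNz opprK mulrzA -mulrzDl addrC.
  move: En; rewrite /comb big_ord_recr /= => En.
  by rewrite pmulrn -mulrzA mulrC mulrzA -pmulrn En mul0rz.
rewrite ltnS leq_eqVlt => /orP[/eqP->//|]; apply: IH; exists n => //.
by move: En; rewrite /comb big_ord_recr /= cM mulr0z addr0.
Qed.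

(** * Structure of strongly co-Hopfian groups *)

(** The image of [X] in G/Y is finite; the representatives in [L] may lie outside [X]. *)
Definition finite_mod (G : zmodType) (X Y : G -> Prop) : Prop :=
  exists L : seq G, forall x, X x -> exists2 y, y \in L & Y (x - y).

Lemma finite_mod_trans (G : zmodType) (X Y Z : G -> Prop) :
  subgroup X -> subgroup Y ->
  finite_mod X Y -> finite_mod (fun x => X x /\ Y x) Z -> finite_mod X Z.
Proof.
move=> sX sY [L HL] [L' HL'].
(* Representatives are first moved into [X], so that [x - r y] lies in both [X] and [Y]. *)
have /choice[r rP] : forall y, exists r, (exists2 x, X x & Y (x - y)) -> X r /\ Y (r - y).
  move=> y; have [[x Xx Yx]|n] := pselect (exists2 x, X x & Y (x - y)).
    by exists x.
  by exists 0.
exists [seq r y + z | y <- L, z <- L'] => x Xx.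
have [y yL Yxy] := HL x Xx.
have [Xr Yr] := rP y (ex_intro2 _ _ x Xx Yxy).
have [|z zL Zxz] := HL' (x - r y).
  split; first exact: subgroupB.
  by rewrite -[x - r y](subrKA y) -[y - r y]opprB; apply: subgroupB.
exists (r y + z); first by apply: allpairs_f.
by rewrite opprD addrA.
Qed.

(** Coefficients may be reduced modulo [p], leaving finitely many combinations of [l]. *)
Lemma seq_span_finite (G : zmodType) (p : nat) (l : seq G) (X Y : G -> Prop) :
  (0 < p)%N -> (forall x, x \in l -> x *+ p = 0) ->
  (forall x, X x -> exists2 y, seq_span l y & Y (x - y)) -> finite_mod X Y.
Proof.
move=> p0 lp XY.
pose F (c : {ffun 'I_(size l) -> 'I_p}) := \sum_(i < size l) l`_i *+ c i.
exists (codom F) => x /XY[_ [c ->] Yx].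
exists (comb (nth 0 l) c (size l)) => //.
have c0 i : 0 <= (c i %% p)%Z by apply: modz_ge0; lia.
have cP i : (`|(c i %% p)%Z| < p)%N.
  by have : (c i %% p)%Z < p by [apply: ltz_pmod; lia]; have := c0 i; lia.
have -> : comb (nth 0 l) c (size l) = F [ffun i : 'I_(size l) => Ordinal (cP i)].
  apply: eq_bigr => i _; rewrite ffunE /= pmulrn.
  have -> : `|(c i %% p)%Z|%N = (c i %% p)%Z :> int.
    by have := c0 i; lia.
  rewrite [in LHS](divz_eq (c i) p) mulrzDr mulrC mulrzA -pmulrn lp ?mul0rz ?add0r //.
  exact: mem_nth.
exact: codom_f.
Qed.

Section Structure.
Variables (G : zmodType) (nu : nat -> nat).
Hypothesis SCH : strongly_coHopfian G.
Hypothesis nuP : forall p (x : G), exists y, x *+ p ^ nu p = y *+ p ^ (nu p).+1.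

Lemma nu_add p k (x : G) : exists y, x *+ p ^ nu p = y *+ p ^ (nu p + k).
Proof.
elim: k => [|k [y ->]]; first by exists x; rewrite addn0.
have [z Ez] := nuP p y; exists z.
by rewrite expnD mulrnA Ez -mulrnA -expnD addSnnS.
Qed.

Definition pdiv_part (p : nat) : G -> Prop := multiples (p ^ nu p).

Lemma pdiv_part_div p x : pdiv_part p x -> exists2 y, pdiv_part p y & x = y *+ p.
Proof.
move=> [y ->]; have [z ->] := nuP p y; exists (z *+ p ^ nu p); first by exists z.
by rewrite expnSr mulrnA.
Qed.

(** With n = [nu p], write p^n x = p^(2n) y and take u = p^n y. *)
Lemma pdiv_part_decomp p x :
  exists2 u, pdiv_part p u & (x - u) *+ p ^ nu p = 0.
Proof.
have [y Ey] := nu_add p (nu p) x; exists (y *+ p ^ nu p); first by exists y.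
by rewrite mulrnBl -mulrnA -expnD -Ey subrr.
Qed.

Definition div_part (x : G) : Prop := forall p, prime p -> pdiv_part p x.

Lemma subgroup_div_part : subgroup div_part.
Proof.
split=> [p _|x y Ax Ay p pp]; first exact: subgroup0 (subgroup_multiples _ _).
by apply: subgroupB (subgroup_multiples _ _) _ _ _ _; [apply: Ax|apply: Ay].
Qed.

(** A quotient of [x] by [q] taken in the [q]-divisible part stays in the other parts, as [q] is
    prime to their p^(nu p). *)
Lemma div_part_divisible : divisible_on div_part.
Proof.
move=> q x pq Ax; have [y Py Ey] := pdiv_part_div (Ax q pq).
exists y => // p pp; have [->//|npq] := eqVneq p q.
apply: (@multiples_coprime G _ q); last by rewrite -Ey; apply: Ax.
by rewrite coprimeXl // prime_coprime // dvdn_prime2.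
Qed.

Definition primary (p : nat) (x : G) : Prop := exists k, x *+ p ^ k = 0.

Lemma subgroup_primary p : subgroup (primary p).
Proof.
split; first by exists 0%N; rewrite mul0rn.
move=> x y [k Ek] [j Ej]; exists (k + j)%N.
by rewrite mulrnBl expnD mulrnA Ek mul0rn mulnC mulrnA Ej mul0rn subrr.
Qed.

Lemma primary_torsion p x : prime p -> primary p x -> torsion x.
Proof. by move=> pp [k Ek]; exists (p ^ k)%N; rewrite // expn_gt0 prime_gt0. Qed.

Definition primary_div (p : nat) (x : G) : Prop := primary p x /\ pdiv_part p x.

Lemma subgroup_primary_div p : subgroup (primary_div p).
Proof.
split; first by split; [exact: subgroup0 (subgroup_primary p)|
  exact: subgroup0 (subgroup_multiples _ _)].
move=> x y [px Px] [py Py]; split; first exact: subgroupB (subgroup_primary p) _ _ _ _.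
exact: subgroupB (subgroup_multiples _ _) _ _ _ _.
Qed.

Lemma primary_div_divisible p : prime p -> divisible_on (primary_div p).
Proof.
move=> pp q x pq [[k Ek] Px]; have [Eqp|nqp] := eqVneq q p.
  rewrite Eqp; have [y Py Ey] := pdiv_part_div Px; exists y => //; split=> //.
  by exists k.+1; rewrite expnS mulrnA -Ey.
have [||m Em] := @divide_coprime G q (p ^ k) x.
- by rewrite coprimeXr // prime_coprime // dvdn_prime2.
- by [].
exists (x *~ m) => //; apply: subgroupMz (subgroup_primary_div p) _ _ _.
by split=> //; exists k.
Qed.

Lemma primary_multiples p q x k : prime p -> prime q -> p != q -> primary q x ->
  multiples (p ^ k) x.
Proof.
move=> pp pq npq [j Ej]; apply: (@multiples_coprime G _ (q ^ j)).
  by rewrite coprimeXl // coprimeXr // prime_coprime // dvdn_prime2.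
by rewrite Ej; apply: subgroup0 (subgroup_multiples _ _).
Qed.

Lemma primary_div_sub p x : prime p -> primary_div p x -> div_part x.
Proof.
move=> pp [px Px] q pq; have [->//|nqp] := eqVneq q p.
exact: primary_multiples px.
Qed.

(** Otherwise the divisible group [div_part] contains an infinite family independent over Z/p. *)
Lemma socle_div_finite p : prime p ->
  finite_mod (fun x : G => x *+ p = 0 /\ div_part x) (fun x => x = 0).
Proof.
move=> pp; pose X (x : G) := x *+ p = 0 /\ div_part x.
have [[l [lX HX]]|[s Hs]] := exhaust_or_sequence X (@seq_span G).
  apply: (seq_span_finite (p := p) (l := l)); first exact: prime_gt0.
    by move=> x /lX[].
  by move=> x /HX Xx; exists x; rewrite ?subrr.
exfalso; have sp i : s i *+ p = 0 by have [[]] := Hs i.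
apply: (no_independent_in_divisible (d := p) (s := s) SCH subgroup_div_part
  div_part_divisible) => [Ep||i]; first by rewrite Ep in pp.
- move=> c M; split=> [c0|dc]; last first.
    apply: big1 => i _; have /dvdzP[k ->] := dc i (ltn_ord i).
    by rewrite mulrC mulrzA -pmulrn sp mul0rz.
  apply: (relation_mod_prime (Y := fun x => x = 0) (s := s)) => //.
    exact: subgroup_zero.
  move=> j c' /subr0_eq E; have [_] := Hs j; apply.
  by rewrite E; apply: seq_span_mkseq.
- by have [[]] := Hs i.
Qed.

(** The dimension of this layer over Z/p is a Ulm-Kaplansky invariant. Were it infinite, writing
    independent s_j as p^i g_j would give g_j spanning a sum of copies of Z/p^(i+1) that avoids
    p^(i+1) G. *)
Lemma socle_layer_finite p i : prime p ->
  finite_mod (fun x : G => x *+ p = 0 /\ multiples (p ^ i) x) (multiples (p ^ i.+1)).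
Proof.
move=> pp; pose X (x : G) := x *+ p = 0 /\ multiples (p ^ i) x.
have [[l [lX HX]]|[s Hs]] := exhaust_or_sequence X
    (fun l x => exists2 y, seq_span l y & multiples (p ^ i.+1) (x - y)).
  apply: (seq_span_finite (p := p) (l := l)) => //; first exact: prime_gt0.
  by move=> x /lX[].
exfalso; have sp j : s j *+ p = 0 by have [[]] := Hs j.
have /choice[g gP] : forall j, exists g, s j = g *+ p ^ i.
  by move=> j; have [[]] := Hs j.
have rel := relation_mod_prime (Y := multiples (p ^ i.+1)) (s := s) pp
  (subgroup_multiples _ _) sp.
have {}rel M c : multiples (p ^ i.+1) (comb s c M) ->
    forall j, (j < M)%N -> (p %| c j)%Z.
  apply: rel => j c' mj; have [_] := Hs j; apply.
  by exists (comb s c' j) => //; apply: seq_span_mkseq.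
have relg c M : multiples (p ^ i.+1) (comb g c M) ->
    forall j, (j < M)%N -> ((p ^ i.+1)%N %| c j)%Z.
  (* Once p^r divides all coefficients, multiplying the relation by p^(i-r) turns it into one among
     the s_j with coefficients c_j / p^r, which [p] divides again. *)
  move=> mg; suff H r : (r <= i.+1)%N -> forall j, (j < M)%N -> ((p ^ r)%N %| c j)%Z.
    exact: H.
  elim: r => [_ j _|r IH ri j jM]; first by rewrite expn0 dvd1z.
  have {}IH := IH (ltnW ri).
  have /rel/(_ j jM)/dvdzP[k Ek] :
      multiples (p ^ i.+1) (comb s (fun j => c j %/ (p ^ r)%N)%Z M).
    have [y Ey] := mg; exists (y *+ p ^ (i - r)).
    rewrite -mulrnA mulnC mulrnA -Ey pmulrn combMz; apply: eq_bigr => j' _.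
    rewrite gP pmulrn -mulrzA; congr (_ *~ _).
    have -> : (p ^ i)%:Z = (p ^ r)%:Z * (p ^ (i - r))%:Z.
      by rewrite -PoszM -expnD subnKC.
    by rewrite mulrAC (mulrC (p ^ r)%:Z) divzK ?IH.
  apply/dvdzP; exists k.
  by rewrite -(divzK (IH j jM)) Ek expnS PoszM mulrA.
have gp j : g j *+ p ^ i.+1 = 0 by rewrite expnSr mulrnA -gP.
have indg : independent (p ^ i.+1) g.
  move=> c M; split=> [c0|dc].
    by apply: relg; rewrite c0; apply: subgroup0 (subgroup_multiples _ _).
  apply: big1 => j _; have /dvdzP[k ->] := dc j (ltn_ord j).
  by rewrite mulrC mulrzA -pmulrn gp mul0rz.
apply: (no_independent_homogeneous SCH pp indg) => c M /relg dc.
exact/indg.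
Qed.

(** The descent starts from G[p] meeting p^(nu p) G, which lies in [div_part], and adds the finitely
    many finite layers above it. *)
Lemma socle_finite p : prime p -> exists L : seq G, forall x, x *+ p = 0 -> x \in L.
Proof.
move=> pp; suff H i : (i <= nu p)%N ->
    finite_mod (fun x : G => x *+ p = 0 /\ multiples (p ^ (nu p - i)) x) (fun x => x = 0).
  have [L HL] := H (nu p) (leqnn _); exists L => x xp.
  have [|y yL /subr0_eq -> //] := HL x.
  by split=> //; exists x; rewrite subnn mulr1n.
elim: i => [_|i IH ni].
  have [L HL] := socle_div_finite pp; exists L => x [xp mx]; apply: HL; split=> //.
  by apply: (primary_div_sub pp); split; [exists 1%N|rewrite subn0 in mx].
have sX j : subgroup (fun x : G => x *+ p = 0 /\ multiples (p ^ j) x).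
  split; first by split; [exact: mul0rn|exact: subgroup0 (subgroup_multiples _ _)].
  move=> x y [xp mx] [yp my]; split; first by rewrite mulrnBl xp yp subrr.
  exact: subgroupB (subgroup_multiples _ _) _ _ _ _.
apply: finite_mod_trans (sX _) (subgroup_multiples _ _) (socle_layer_finite _ pp) _.
have [L HL] := IH (ltnW ni); exists L => x [[xp _] mx]; apply: HL; split=> //.
by move: mx; rewrite subnSK.
Qed.

(** Multiplication by [p] maps G[p^(r+1)] to G[p^r] with fibres that are cosets of the finite
    socle. *)
Lemma killed_by_pow_finite p r : prime p ->
  exists L : seq G, forall x, x *+ p ^ r = 0 -> x \in L.
Proof.
move=> pp; have [L1 HL1] := socle_finite pp.
elim: r => [|r [L HL]]; first by exists [:: 0] => x; rewrite mulr1n inE => ->.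
have /choice[g gP] : forall y : G, exists g, (exists x, x *+ p = y) -> g *+ p = y.
  move=> y; have [[x Ex]|n] := pselect (exists x, x *+ p = y); first by exists x.
  by exists 0.
exists [seq g y + z | y <- L, z <- L1] => x; rewrite expnS mulrnA => /HL xL.
rewrite -[x](subrK (g (x *+ p))) addrC; apply: allpairs_f => //.
by apply: HL1; rewrite mulrnBl gP ?subrr //; exists x.
Qed.

Lemma div_part_rank : exists l : seq G, forall x, div_part x ->
  exists2 n, (0 < n)%N & exists2 y, seq_span l y & torsion (x *+ n - y).
Proof.
have [[l [lX HX]]|[s Hs]] := exhaust_or_sequence div_part (fun l x =>
    exists2 n, (0 < n)%N & exists2 y, seq_span l y & torsion (x *+ n - y)).
  by exists l.
exfalso; apply: (no_independent_in_divisible (d := 0) (s := s) SCH subgroup_div_part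
  div_part_divisible) => // [|i]; last by have [] := Hs i.
move=> c M; split=> [c0 i iM|dc]; last first.
  apply: big1 => i _; have := dc i (ltn_ord i).
  by rewrite dvd0z => /eqP ->; rewrite mulr0z.
rewrite dvd0z; apply/eqP; apply: (@relation_mod_torsion G s _ M) iM => //; last first.
  by exists 1%N; rewrite // c0 mul0rn.
move=> j n c' n0 t; have [_] := Hs j; apply.
by exists n => //; exists (comb s c' j) => //; apply: seq_span_mkseq.
Qed.

(** Let D = [primary_div p], which is divisible, and let f retract G onto D. Then G is the direct
    sum of the primary component and of the kernel of f inside p^(nu p) G. *)
Lemma primary_proj p : prime p -> exists f : G -> G,
  [/\ forall x y, f (x + y) = f x + f y, forall x, primary p (f x) &
      forall x, primary p x -> f x = x].
Proof.
move=> pp; have sD := subgroup_primary_div p; have sT := subgroup_primary p.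
have sP := @subgroup_multiples G (p ^ nu p).
have [f [fD fR fE]] : exists f : G -> G, [/\ forall x y, f (x + y) = f x + f y,
    forall x y, x = y /\ primary_div p x -> f x = y & forall x, primary_div p (f x)].
  apply: extend_to_divisible => //; first exact: primary_div_divisible.
  - by split=> //; apply: subgroup0.
  - by move=> y [].
  - by move=> x y x' y' [<- Dx] [<- Dx']; split=> //; apply: subgroupB.
  - by move=> x y [<-].
have ef := endo_whole fD; have sW := subgroup_whole G.
have fid x : primary_div p x -> f x = x by move=> Dx; apply: fR.
(* [y] is the component of [x] in that decomposition. Uniqueness holds because an element of both
   summands lies in D, where f is the identity. *)
pose R x y := [/\ primary p y, pdiv_part p (x - y) & f (x - y) = 0].
have Ry x : exists y, R x y.
  have [u Pu Eu] := pdiv_part_decomp p x.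
  have [tfu Pfu] := fE u.
  exists (x - u + f u).
  have E : x - (x - u + f u) = u - f u.
    by rewrite opprD opprB addrA [x + _]addrC subrK.
  split; rewrite ?E.
  - by apply: subgroupD => //; exists (nu p).
  - exact: subgroupB.
  - by rewrite (endoB sW ef) // (fid (f u)) // subrr.
have R0 y : R 0 y -> y = 0.
  move=> [ty]; rewrite sub0r => Py fy; have Dy : primary_div p (- y).
    by split=> //; apply: subgroupN.
  by apply: oppr_inj; rewrite -[LHS](fid _ Dy) fy oppr0.
have RB x y x' y' : R x y -> R x' y' -> R (x - x') (y - y').
  move=> [ty Py fy] [ty' Py' fy'].
  split; rewrite 1?subrACA; [exact: subgroupB|exact: (subgroupB sP)|].
  by rewrite (endoB sW ef) // fy fy' subrr.
have [g [gD gR]] := graph_fun Ry R0 RB; exists g; split=> // x.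
  by have [y Rxy] := Ry x; rewrite (gR _ _ Rxy); case: Rxy.
move=> tx; apply: gR; split=> //; rewrite subrr; last exact: (endo0 sW ef).
exact: subgroup0.
Qed.

End Structure.

Lemma nu_exists (G : zmodType) : strongly_coHopfian G ->
  exists nu : nat -> nat, forall p (x : G), exists y, x *+ p ^ nu p = y *+ p ^ (nu p).+1.
Proof.
move=> SCH; suff /choice[nu nuP] : forall p : nat, exists n, forall x : G,
  exists y, x *+ p ^ n = y *+ p ^ n.+1 by exists nu.
move=> p; have ef : endo_on (@whole G) (fun x => x *+ p).
  by apply: endo_whole => x y; rewrite mulrnDl.
have [n /(same_imgP ef) st] := SCH _ ef; exists n => x.
have [//|y _ Ey] := st x; exists y.
have it k z : iter k (fun x : G => x *+ p) z = z *+ p ^ k.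
  by elim: k => [|k IH]; rewrite ?mulr1n // iterS IH expnSr mulrnA.
by rewrite -!it.
Qed.

(** * Gluing over the primary components *)

(** Indices add along an extension: [b] steps for S/S' leave a defect in [S'], which [a] more steps
    push into arbitrarily high images of [S']. *)
Lemma stable_extension (G : zmodType) (S S' : G -> Prop) (f : G -> G) (a b : nat) :
  subgroup S -> endo_on S f -> endo_on S' f -> (forall x, S' x -> S x) ->
  (forall x, S x -> exists2 y, S y & S' (iter b f x - iter b.+1 f y)) ->
  stable_at S' f a -> stable_at S f (b + a).
Proof.
move=> sS ef ef' sub quo st x Sx.
have [y Sy S'd] := quo x Sx.
have [z S'z Ez] := img_stable st b.+1 S'd.
exists (y + z); first by apply: subgroupD => //; apply: sub.
have [cb _] := endo_iter ef b; have [cb1 _] := endo_iter ef b.+1.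
move: Ez; rewrite (endoB sS (endo_iter ef a)) //; [|exact: cb|exact: cb1].
rewrite -!iterD => /eqP; rewrite subr_eq => /eqP; rewrite addnC => ->.
rewrite (_ : (b + a).+1 = (a + b.+1)%N); last by lia.
have Sz := sub z S'z.
by rewrite (endoD (endo_iter ef (a + b.+1)) Sy Sz) addrC.
Qed.

Lemma subgroup_torsion (G : zmodType) : subgroup (@torsion G).
Proof.
split; first by exists 1%N.
move=> x y [m m0 Em] [n n0 En]; exists (m * n)%N; first by rewrite muln_gt0 m0.
by rewrite mulrnBl mulrnA Em mul0rn mulnC mulrnA En mul0rn subrr.
Qed.

Lemma torsion_mulrn (G : zmodType) n (x : G) : (0 < n)%N -> torsion (x *+ n) -> torsion x.
Proof.
move=> n0 [m m0 Em]; exists (n * m)%N; first by rewrite muln_gt0 n0.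
by rewrite mulrnA.
Qed.

Lemma endo_torsion (G : zmodType) (f : G -> G) :
  endo_on (@whole G) f -> endo_on (@torsion G) f.
Proof.
move=> ef; apply: (endo_on_sub ef) => // x [n n0 En]; exists n => //.
by rewrite -(endoMn (subgroup_whole G) ef) // En (endo0 (subgroup_whole G) ef).
Qed.

Lemma endo_primary (G : zmodType) (f : G -> G) p :
  prime p -> endo_on (@torsion G) f -> endo_on (@primary G p) f.
Proof.
move=> pp ef; apply: (endo_on_sub ef) => x; first exact: primary_torsion.
move=> tx; have Tx := primary_torsion pp tx; have [k Ek] := tx; exists k.
by rewrite -(endoMn (subgroup_torsion G) ef) // Ek (endo0 (subgroup_torsion G) ef).
Qed.

Section PrimaryComponents.
Variables (G : zmodType) (pi : nat -> G -> G).
Hypothesis piD : forall p, prime p -> forall x y, pi p (x + y) = pi p x + pi p y.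
Hypothesis pi_primary : forall p, prime p -> forall x, primary p (pi p x).
Hypothesis pi_id : forall p, prime p -> forall x, primary p x -> pi p x = x.

Let sW := subgroup_whole G.
Let epi p (pp : prime p) := endo_whole (piD pp).

Lemma pi_kill p (n : nat) x : prime p -> ~~ (p %| n)%N -> x *+ n = 0 -> pi p x = 0.
Proof.
move=> pp np xn; have [k Ek] := pi_primary pp x.
apply: (@subgroup_coprime G (fun z => z = 0) _ (p ^ k) n) => //.
- exact: subgroup_zero.
- by rewrite coprimezE /= coprimeXl // prime_coprime.
- by rewrite -pmulrn -(endoMn sW (epi pp)) // xn (endo0 sW (epi pp)).
Qed.

Lemma pi_primary0 p q x : prime p -> prime q -> p != q -> primary q x -> pi p x = 0.
Proof.
move=> pp pq npq [k Ek]; apply: (pi_kill (n := q ^ k) pp) => //.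
by rewrite Euclid_dvdX // dvdn_prime2 // (negPf npq).
Qed.

(** If all components of z vanish and the claim holds for q z, then q z = 0, so z is [q]-primary and
    equals its own component. *)
Lemma torsion_pi0 x : torsion x -> (forall p, prime p -> pi p x = 0) -> x = 0.
Proof.
move=> [n n0 En].
apply: (@subgroup_pure G (fun z => (forall p, prime p -> pi p z = 0) -> z = 0) _ n) => //.
move=> q z pq IH zp; have zq : z *+ q = 0.
  by apply: IH => p pp; rewrite (endoMn sW (epi pp)) // zp // mul0rn.
by rewrite -(pi_id pq (x := z)) ?zp //; exists 1%N.
Qed.

Lemma torsion_pi_inj x y : torsion x -> torsion y ->
  (forall p, prime p -> pi p x = pi p y) -> x = y.
Proof.
move=> Tx Ty E; apply: subr0_eq; apply: torsion_pi0.
  exact: (subgroupB (subgroup_torsion G)).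
by move=> p pp; rewrite (endoB sW (epi pp)) // E // subrr.
Qed.

Lemma glue_components (y : nat -> G) (n : nat) :
  (forall p, prime p -> primary p (y p)) ->
  (forall p, prime p -> (n < p)%N -> y p = 0) ->
  torsion (\sum_(p < n.+1 | prime p) y p) /\
  forall p, prime p -> pi p (\sum_(p < n.+1 | prime p) y p) = y p.
Proof.
move=> yp yn; split.
  apply: (subgroup_sum (subgroup_torsion G)) => p pp.
  by apply: (primary_torsion pp); apply: yp.
move=> p pp; rewrite (endo_sum sW (epi pp)) //.
have kill (q : 'I_n.+1) : prime q -> q != p :> nat -> pi p (y q) = 0.
  by move=> pq nqp; apply: (pi_primary0 pp pq) (yp _ pq); rewrite eq_sym.
have [pn|pn] := ltnP p n.+1.
  rewrite (bigD1 (Ordinal pn)) //= (pi_id pp) ?big1 ?addr0 //; last exact: yp.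
  by move=> q /andP[pq nqp]; apply: kill.
rewrite yn // big1 // => q pq; apply: kill => //.
by rewrite ltn_eqF //; apply: leq_trans (ltn_ord q) pn.
Qed.

(** T is the direct sum of its primary components: an element killed by n has nonzero components
    only at primes dividing n, so a finite sum glues the values. *)
Lemma glue_endo (F : nat -> G -> G) :
  (forall p, prime p -> endo_on (@primary G p) (F p)) ->
  exists2 f, endo_on (@torsion G) f &
    forall p x, prime p -> torsion x -> pi p (f x) = F p (pi p x).
Proof.
move=> eF.
have /choice[f fP] : forall x : G, exists z, torsion x ->
    torsion z /\ forall p, prime p -> pi p z = F p (pi p x).
  move=> x; have [[n n0 En]|nT] := pselect (torsion x); last by exists 0.
  have [p pp|p pp np|Tz piz] := @glue_components (fun p => F p (pi p x)) n.
  - by apply: (endo_closed (eF p pp)); apply: pi_primary.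
  - have -> : pi p x = 0.
      by apply: (pi_kill (n := n)) => //; apply/negP => /dvdn_leq; lia.
    exact: endo0 (@subgroup_primary G p) (eF p pp).
  - by eexists => _; split; [exact: Tz|exact: piz].
exists f => [|p x pp Tx]; last by have [_] := fP x Tx; apply.
have sT := subgroup_torsion G.
split=> [x Tx|x y Tx Ty]; first by have [] := fP x Tx.
have [Tfx fx] := fP x Tx; have [Tfy fy] := fP y Ty.
have [Tfxy fxy] := fP _ (subgroupD sT Tx Ty).
apply: torsion_pi_inj => // [|p pp]; first exact: subgroupD.
rewrite fxy // (piD pp) (piD pp) (endoD (eF p pp)) ?fx ?fy //; exact: pi_primary.
Qed.

Lemma stable_components f n : endo_on (@torsion G) f ->
  (forall p, prime p -> stable_at (@primary G p) f n) -> stable_at (@torsion G) f n.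
Proof.
move=> ef st x Tx; have [m m0 Em] := Tx; have sT := subgroup_torsion G.
have [p pp|p pp np|Tz piz] := @glue_components (fun p => pi p x) m.
- exact: pi_primary.
- by apply: (pi_kill (n := m)) => //; apply/negP => /dvdn_leq; lia.
rewrite (torsion_pi_inj Tx Tz) => [|p pp]; last by rewrite piz.
have efn := endo_iter ef n.
rewrite (endo_sum sT efn) => [|p pp]; last first.
  by apply: (primary_torsion pp); apply: pi_primary.
apply: (subgroup_sum (img_subgroup sT (endo_iter ef n.+1))) => p pp.
have [y ty ->] := st p pp _ (pi_primary pp x).
by exists y => //; apply: (primary_torsion pp).
Qed.

(** Each [F p] has the largest index possible on its component, so the index of the glued
    endomorphism of T bounds all others. *)
Lemma torsion_uniform :
  (forall p, prime p -> exists m, forall f, endo_on (@primary G p) f ->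
    stable_at (@primary G p) f m) ->
  strongly_coHopfian_on (@torsion G) ->
  exists N, forall p f, prime p -> endo_on (@primary G p) f ->
    stable_at (@primary G p) f N.
Proof.
move=> bound TSCH.
have /choice[F FP] : forall p, exists F, prime p -> endo_on (@primary G p) F /\
    forall n, stable_at (@primary G p) F n ->
    forall g, endo_on (@primary G p) g -> stable_at (@primary G p) g n.
  move=> p; have [pp|npp] := boolP (prime p); last by exists id.
  pose Q m := `[< forall f, endo_on (@primary G p) f -> stable_at (@primary G p) f m >].
  have exQ : exists m, Q m by have [m Hm] := bound p pp; exists m; apply/asboolP.
  (* At least uniform bound 0 any [F] will do; at least bound m + 1 some [F] is not yet stable at
     [m]. *)
  case: (ex_minnP exQ) => -[|m] /asboolP Qm minm.
    exists id => _; split=> [//|n _ g eg]; exact: img_stable_le (leq0n n) (Qm _ eg).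
  have /existsNP[F /not_implyP[eF nst]] :
      ~ forall f, endo_on (@primary G p) f -> stable_at (@primary G p) f m.
    by move=> /asboolP/minm; rewrite ltnn.
  exists F => _.
  split=> // n st g eg; apply: img_stable_le (Qm _ eg).
  by rewrite ltnNge; apply/negP => nm; apply: nst; apply: img_stable_le nm st.
have [p pp|f ef fP] := @glue_endo F; first by have [] := FP p pp.
have [n /(same_imgP ef) st] := TSCH f ef; exists n => p g pp.
have [eF maxF] := FP p pp; apply: maxF => x tx.
have it k y : torsion y -> pi p (iter k f y) = iter k (F p) (pi p y).
  move=> Ty; elim: k => // k IH; rewrite !iterS fP ?IH //.
  by have [cl _] := endo_iter ef k; apply: cl.
have Tx := primary_torsion pp tx; have [y Ty Ey] := st x Tx.
exists (pi p y); first exact: pi_primary.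
by rewrite -it // -Ey it // pi_id.
Qed.

End PrimaryComponents.

(** * Pigeonhole and descending chains of finite length *)

Lemma pigeonhole (T : eqType) (L : seq T) (u : nat -> T) :
  (forall i, u i \in L) -> exists i j, [/\ (i < j)%N, (j <= size L)%N & u i = u j].
Proof.
move=> uL; have : ~~ uniq (mkseq u (size L).+1).
  apply/negP => uu; have : (size (mkseq u (size L).+1) <= size L)%N.
    by apply: uniq_leq_size uu _ => _ /mapP[i _ ->].
  by rewrite size_mkseq ltnn.
move=> /(uniqPn (u 0%N))[i [j [ij]]]; rewrite size_mkseq => jL.
by rewrite !nth_mkseq ?(ltn_trans ij) // => E; exists i, j; split.
Qed.

(** If all inclusions up to [size L] were strict, elements of X_j outside X_(j+1) would give
    [size L] + 1 distinct classes modulo [Y]. The bound depends on [L] alone, hence is uniform over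
    chains. *)
Lemma finite_chain_stable (G : zmodType) (X : nat -> G -> Prop) (Y : G -> Prop) (L : seq G) :
  subgroup Y -> (forall j, subgroup (X j)) -> (forall j x, X j.+1 x -> X j x) ->
  (forall j x, Y x -> X j x) ->
  (forall x, X 0%N x -> exists2 y, y \in L & Y (x - y)) ->
  exists2 j, (j <= size L)%N & forall x, X j x -> X j.+1 x.
Proof.
move=> sY sX dec YX cov; apply: contrapT => nst.
have le i j x : (i <= j)%N -> X j x -> X i x.
  move=> /subnKC <-; elim: (j - i)%N => [|k IH]; first by rewrite addn0.
  by rewrite addnS => /dec.
have /choice[x xP] : forall j, exists x, (j <= size L)%N -> X j x /\ ~ X j.+1 x.
  move=> j; have [jL|] := leqP j (size L); last by exists 0.
  apply: contrapT => no; apply: nst; exists j => // x Xx.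
  by apply: contrapT => nX; apply: no; exists x.
have X0 j : X 0%N (x (minn j (size L))).
  have [//|Xj _] := xP (minn j (size L)); first exact: geq_minr.
  exact: le Xj.
have /choice[r rP] : forall j, exists y, y \in L /\ Y (x (minn j (size L)) - y).
  by move=> j; have [y yL Yy] := cov _ (X0 j); exists y.
have [|i [j [ij jL Er]]] := @pigeonhole _ L r; first by move=> i; have [] := rP i.
have [_ Yi] := rP i; have [_ Yj] := rP j.
have iL : (i <= size L)%N by rewrite (leq_trans (ltnW ij)).
move: Yi Yj; rewrite (minn_idPl iL) (minn_idPl jL) Er => Yi Yj.
have [_] := xP i iL; apply.
rewrite -[x i](subrK (x j)); apply: (subgroupD (sX _)).
  by apply: YX; rewrite -[x i - x j](subrKA (r j)) -[r j - x j]opprB; apply: subgroupB.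
by have [Xj _] := xP j jL; apply: le Xj.
Qed.

(** * Bounds on the index *)

Lemma divisible_mulrn (G : zmodType) (E : G -> Prop) : divisible_on E ->
  forall n x, (0 < n)%N -> E x -> exists2 y, E y & x = y *+ n.
Proof.
move=> dE; elim/ltn_ind => n IH x n0 Ex.
have [n1|n1] := leqP n 1.
  by exists x => //; have -> : n = 1%N by lia.
have pq := pdiv_prime n1; have dq := pdiv_dvd n.
have [y Ey ->] := dE _ _ pq Ex.
have [||z Ez ->] := IH (n %/ pdiv n)%N _ y _ Ey.
- exact: ltn_Pdiv (prime_gt1 pq) n0.
- by rewrite divn_gt0 ?prime_gt0 // dvdn_leq.
by exists z => //; rewrite -mulrnA divnK.
Qed.

Lemma divisible_mulrz (G : zmodType) (E : G -> Prop) : subgroup E -> divisible_on E ->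
  forall (m : int) x, m != 0 -> E x -> exists2 y, E y & x = y *~ m.
Proof.
move=> sE dE [n|n] x m0 Ex.
  by have [|y Ey ->] := divisible_mulrn dE (n := n) _ Ex; [lia|exists y].
have [//|y Ey ->] := divisible_mulrn dE (n := n.+1) _ Ex.
by exists (- y); [exact: subgroupN|rewrite /intmul mulNrn opprK].
Qed.

Lemma torsion_mulrz (G : zmodType) (m : int) (x : G) :
  m != 0 -> torsion (x *~ m) -> torsion x.
Proof.
case: m => n m0; first by apply: torsion_mulrn; lia.
rewrite NegzE mulrNz => /(subgroupN (subgroup_torsion G)); rewrite opprK.
exact: (torsion_mulrn (n := n.+1)).
Qed.

Lemma endo_primary_div (G : zmodType) (nu : nat -> nat) p (f : G -> G) :
  endo_on (@primary G p) f -> endo_on (@primary_div G nu p) f.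
Proof.
move=> ef; apply: (endo_on_sub ef) => [x []//|x [[k Ek] [y Ey]]]; split.
  by apply: (endo_closed ef); exists k.
(* [f] is additive only on the primary component, so [y] must be seen to lie there. *)
have ty : primary p y by exists (nu p + k)%N; rewrite expnD mulrnA -Ey.
by exists (f y); rewrite Ey (endoMn (@subgroup_primary G p) ef).
Qed.

Section Bounds.
Variables (G : zmodType) (nu : nat -> nat).
Hypothesis SCH : strongly_coHopfian G.
Hypothesis nuP : forall p (x : G), exists y, x *+ p ^ nu p = y *+ p ^ (nu p).+1.

(** The socles of the images of the divisible part D stabilise within the size of the finite socle
    of G; divisibility then lifts this from the socle to all of D. *)
Lemma primary_div_stable p : prime p -> exists m, forall f,
  endo_on (@primary G p) f -> stable_at (primary_div nu p) f m.
Proof.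
move=> pp; have [L HL] := socle_finite SCH nuP pp; exists (size L) => f ef.
have sT := @subgroup_primary G p; have sD := @subgroup_primary_div G nu p.
have DT (x : G) : primary_div nu p x -> primary p x by case.
have eD := endo_primary_div nu ef.
have sI j := img_subgroup sD (endo_iter eD j).
pose X j x := img (iter j f) (primary_div nu p) x /\ x *+ p = 0.
have [j jL stj] : exists2 j, (j <= size L)%N & forall x, X j x -> X j.+1 x.
  apply: (@finite_chain_stable G X (fun x => x = 0)).
  - exact: subgroup_zero.
  - move=> j; split; first by split; [exact: subgroup0|exact: mul0rn].
    move=> x y [Ix xp] [Iy yp]; split; first exact: subgroupB.
    by rewrite mulrnBl xp yp subrr.
  - by move=> j x [Ix xp]; split=> //; apply: (img_iter_add (j := 1) eD); rewrite addn1.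
  - by move=> j x ->; split; [exact: subgroup0|exact: mul0rn].
  - by move=> x [_ /HL xL]; exists x; rewrite ?subrr.
apply: (img_stable_le jL) => x Dx.
(* Induction on the exponent: if p y = f^(j+1)(e) and e = p e', then y - f^(j+1)(e') is in the socle
   of the image of f^j. *)
have H k y : y *+ p ^ k = 0 -> img (iter j f) (primary_div nu p) y ->
    img (iter j.+1 f) (primary_div nu p) y.
  elim: k y => [|k IH] y; first by rewrite mulr1n => -> _; apply: subgroup0.
  rewrite expnS mulrnA => Ek Iy.
  have [e De Ee] := IH _ Ek (subgroupMn (sI j) p Iy).
  have [e' De' Ee'] := primary_div_divisible nuP pp pp De.
  rewrite -[y](subrK (iter j.+1 f e')); apply: (subgroupD (sI _)); last by exists e'.
  suff /stj[] : X j (y - iter j.+1 f e') by [].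
  split.
    apply: (subgroupB (sI j)) => //; apply: (img_iter_add (j := 1) eD).
    by rewrite addn1; exists e'.
  by rewrite mulrnBl Ee Ee' (endoMn sD (endo_iter eD j.+1)) // subrr.
have [cl _] := endo_iter eD j; have [[k Ek] _] := cl x Dx.
by apply: (H k) => //; exists x.
Qed.

(** The component is finite modulo its divisible part D, so the chain f^j(T_p) + D stabilises in
    bounded time; D itself is handled by [primary_div_stable]. *)
Lemma primary_bounded p : prime p -> exists m, forall f,
  endo_on (@primary G p) f -> stable_at (@primary G p) f m.
Proof.
move=> pp; have [a Ha] := primary_div_stable pp.
have [L HL] := killed_by_pow_finite SCH nuP (nu p) pp.
exists (size L + a)%N => f ef.
have sT := @subgroup_primary G p; have sD := @subgroup_primary_div G nu p.
have sP := @subgroup_multiples G (p ^ nu p).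
have DT (x : G) : primary_div nu p x -> primary p x by case.
have eD := endo_primary_div nu ef.
pose X j x := primary p x /\ exists2 t, primary p t & primary_div nu p (x - iter j f t).
have [j jL stj] : exists2 j, (j <= size L)%N & forall x, X j x -> X j.+1 x.
  apply: (@finite_chain_stable G X (primary_div nu p)) => //.
  - move=> j; have efj := endo_iter ef j; split.
      split; first exact: subgroup0.
      by exists 0; rewrite ?(endo0 sT efj) ?subrr; apply: subgroup0.
    move=> x y [tx [t tt Dt]] [ty [t' tt' Dt']]; split; first exact: subgroupB.
    exists (t - t'); first exact: subgroupB.
    rewrite (endoB sT efj) //.
    rewrite subrACA.
    exact: (subgroupB sD).
  - move=> j x [tx [t tt Dt]]; split=> //; exists (f t); first exact: (endo_closed ef).
    by rewrite -iterSr.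
  - move=> j x Dx; split; first exact: DT.
    by exists 0; rewrite ?(endo0 sT (endo_iter ef j)) ?subr0 //; apply: subgroup0.
  - move=> x [tx _]; have [u Pu Eu] := pdiv_part_decomp nuP p x.
    exists (x - u); first exact: HL.
    rewrite opprB addrC subrK; split=> //.
    rewrite -[u](subKr x); apply: (subgroupB sT) => //; by exists (nu p).
suff st : stable_at (@primary G p) f (j + a).
  by apply: (img_stable_le _ st); rewrite leq_add2r.
apply: (stable_extension sT ef eD DT) => [x tx|]; last exact: Ha.
have [cl _] := endo_iter ef j.
have [|_ [t tt Dt]] := stj (iter j f x); last by exists t.
split; first exact: cl.
by exists x; rewrite ?subrr //; apply: subgroup0.
Qed.

Variables (f : G -> G) (N : nat).
Hypothesis ef : endo_on (@whole G) f.
Hypothesis stN : forall p, prime p -> stable_at (@primary G p) f N.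

Let sW := subgroup_whole G.
Let efi n : endo_on (@whole G) (iter n f) := endo_iter ef n.

Lemma pdiv_part_iter p n x : pdiv_part nu p x -> pdiv_part nu p (iter n f x).
Proof. by move=> [y ->]; exists (iter n f y); rewrite (endoMn sW (efi n)). Qed.

Lemma div_part_iter n x : div_part nu x -> div_part nu (iter n f x).
Proof. by move=> Ax p pp; apply: pdiv_part_iter; apply: Ax. Qed.

(* A surjective endomorphism of the finite group [f^N(G) + P / P] is injective. *)
Lemma kernel_step p u : prime p -> pdiv_part nu p (f (iter N f u)) ->
  pdiv_part nu p (iter N f u).
Proof.
move=> pp Pf; have sP : subgroup (@pdiv_part G nu p) by apply: subgroup_multiples.
(* Surjectivity modulo P: [x] may be replaced by an element killed by p^(nu p), where [stN]
   applies. *)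
have /choice[next nextP] : forall x, exists y,
    pdiv_part nu p (iter N f x - f (iter N f y)).
  move=> x; have [v Pv Ev] := pdiv_part_decomp nuP p x.
  have [|y _ Ey] := stN pp (x := x - v); first by exists (nu p).
  exists y; rewrite -iterS -Ey (endoB sW (efi N)) // subKr.
  exact: pdiv_part_iter.
have [L HL] := killed_by_pow_finite SCH nuP (nu p) pp.
have /choice[r rP] : forall x, exists y, y \in L /\ pdiv_part nu p (x - y).
  move=> x; have [v Pv Ev] := pdiv_part_decomp nuP p x.
  by exists (x - v); split; [exact: HL|rewrite subKr].
(* A backward orbit of f^N(u) modulo P. If w_i and w_j agree there with i < j, then f^j kills w_i,
   hence w_j, modulo P, and f^j(w_j) is w_0. *)
pose w j := iter N f (iter j next u).
have wP j : pdiv_part nu p (w 0%N - iter j f (w j)).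
  elim: j => [|j IH]; first by rewrite subrr; apply: subgroup0.
  rewrite -[w 0%N - _](subrKA (iter j f (w j))); apply: subgroupD => //.
  by rewrite iterSr -(endoB sW (efi j)) //; apply: pdiv_part_iter; apply: nextP.
have [|i [j [ij _ Er]]] := @pigeonhole _ L (r \o w).
  by move=> i; have [] := rP (w i).
have Pij : pdiv_part nu p (w i - w j).
  have [_ Pi] := rP (w i); have [_ Pj] := rP (w j); rewrite /= in Er.
  rewrite -[w i - w j](subrKA (r (w i))) {2}Er -[r (w j) - w j]opprB.
  exact: subgroupB.
have Pfi : pdiv_part nu p (iter i.+1 f (w i)).
  rewrite iterS; have := pdiv_part_iter 1 (wP i); rewrite /= (endoB sW ef) // => P1.
  by rewrite -[f _](subKr (f (w 0%N))); apply: subgroupB.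
have Pji : pdiv_part nu p (iter j f (w i)).
  by rewrite -(subnK ij) iterD; apply: pdiv_part_iter.
have := pdiv_part_iter j Pij; rewrite (endoB sW (efi j)) // => Pd.
have Pjj : pdiv_part nu p (iter j f (w j)).
  by rewrite -[iter j f (w j)](subKr (iter j f (w i))); apply: subgroupB.
by rewrite -[iter N f u]/(w 0%N) -[w 0%N](subrK (iter j f (w j))); apply: subgroupD.
Qed.

Lemma kernel_stable p n u : prime p -> pdiv_part nu p (iter n f u) ->
  pdiv_part nu p (iter N f u).
Proof.
move=> pp; have [nN|Nn] := leqP n N.
  by rewrite -(subnK nN) iterD; apply: pdiv_part_iter.
rewrite -(subnK (ltnW Nn)); elim: (n - N)%N => // k IH.
by rewrite addSn iterS addnC iterD => /(kernel_step pp); rewrite -iterD addnC.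
Qed.

(** The index n given by [SCH] depends on [f]; [kernel_stable] replaces it by [N] at every prime
    simultaneously. *)
Lemma image_mod_div_part x : exists y, div_part nu (iter N f x - iter N.+1 f y).
Proof.
have [n /(same_imgP ef)/(_ x I)[z _ Ez]] := SCH ef.
exists z => p pp; rewrite iterSr -(endoB sW (efi N)) //.
apply: (kernel_stable (n := n)) => //.
rewrite (endoB sW (efi n)) // -iterSr -Ez subrr.
exact: subgroup0 (subgroup_multiples _ _).
Qed.

End Bounds.

(** r + 1 vectors of length r are dependent over the rationals; denominators are then cleared. *)
Lemma int_relation (r : nat) (c : nat -> nat -> int) : exists e : nat -> int,
  (exists2 j, (j <= r)%N & e j != 0) /\
  forall i, (i < r)%N -> \sum_(j < r.+1) e j * c j i = 0.
Proof.
pose A : 'M[rat]_(r.+1, r) := \matrix_(j, i) (c j i)%:~R.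
have : kermx A != 0.
  rewrite kermx_eq0 -row_leq_rank -ltnNge ltnS; exact: rank_leq_col.
move=> /rowV0Pn[v /sub_kermxP vA /rV0Pn[j0 vj0]].
(* This is v_j times the product [d] of all denominators, written so as to be visibly an integer. *)
pose e j : int := if insub j is Some j' then
  numq (v 0 j') * \prod_(k | k != j') denq (v 0 k) else 0.
pose d : int := \prod_k denq (v 0 k).
have eE (j : 'I_r.+1) : (e j)%:~R = v 0 j * d%:~R :> rat.
  have -> : d = denq (v 0 j) * \prod_(k | k != j) denq (v 0 k) by rewrite /d (bigD1 j).
  rewrite /e valK !intrM mulrA; congr (_ * _).
  by rewrite -{2}[v 0 j]divq_num_den mulfVK // intr_eq0 denq_neq0.
have d0 : d%:~R != 0 :> rat.
  by rewrite intr_eq0; apply/prodf_neq0 => k _; apply: denq_neq0.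
exists e; split.
  exists (val j0); first by rewrite -ltnS ltn_ord.
  by rewrite -(intr_eq0 rat) eE mulf_neq0.
move=> i ir; apply/eqP; rewrite -(intr_eq0 rat); apply/eqP.
have := congr1 (fun B : 'rV_r => B 0 (Ordinal ir) * d%:~R) vA.
rewrite !mxE mul0r mulr_suml (raddf_sum (intmul 1)) /= => E0.
by rewrite -[RHS]E0; apply: eq_bigr => j _; rewrite intrM eE !mxE mulrAC.
Qed.

(** Modulo torsion [A] is a rational vector space of dimension at most [size l], so its descending
    images stabilise. Otherwise elements f^j(x_j) outside f^(j+1)(A) + T would satisfy an integer
    relation modulo T. *)
Lemma rank_stable (G : zmodType) (A : G -> Prop) (l : seq G) (f : G -> G) :
  subgroup A -> divisible_on A -> endo_on (@whole G) f -> endo_on A f ->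
  (forall x, A x ->
    exists2 n, (0 < n)%N & exists2 y, seq_span l y & torsion (x *+ n - y)) ->
  exists2 j, (j <= size l)%N &
    forall x, A x -> exists2 y, A y & torsion (iter j f x - iter j.+1 f y).
Proof.
move=> sA dA ef eA rk; have sT := subgroup_torsion G; have sW := subgroup_whole G.
apply: contrapT => nst.
have /choice[x xP] : forall j, exists x, (j <= size l)%N ->
    A x /\ forall y, A y -> ~ torsion (iter j f x - iter j.+1 f y).
  move=> j; have [jl|] := leqP j (size l); last by exists 0.
  apply: contrapT => no; apply: nst; exists j => // x Ax.
  apply: contrapT => nx; apply: no; exists x => _; split=> // y Ay ty.
  by apply: nx; exists y.
have /choice[nc ncP] : forall j, exists nc : nat * (nat -> int), (j <= size l)%N ->
    (0 < nc.1)%N /\ torsion (iter j f (x j) *+ nc.1 - comb (nth 0 l) nc.2 (size l)).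
  move=> j; have [jl|] := leqP j (size l); last by exists (0%N, fun=> 0).
  have [Ax _] := xP j jl; have [cl _] := endo_iter eA j.
  by have [n n0 [_ [c ->] t]] := rk _ (cl _ Ax); exists (n, c).
have [e [exj rel]] := int_relation (size l) (fun j => (nc j).2).
have : torsion (\sum_(j < (size l).+1) iter j f (x j) *~ ((nc j).1%:Z * e j)).
  have -> : \sum_(j < (size l).+1) iter j f (x j) *~ ((nc j).1%:Z * e j) =
      \sum_(j < (size l).+1)
        (iter j f (x j) *+ (nc j).1 - comb (nth 0 l) (nc j).2 (size l)) *~ e j.
    apply/eqP; rewrite -subr_eq0 -sumrB; apply/eqP.
    under eq_bigr => j _ do rewrite mulrzBl mulrzA opprB addrC subrK /comb mulrz_suml.
    rewrite exchange_big big1 //= => i _.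
    under eq_bigr => j _ do rewrite -mulrzA mulrC.
    by rewrite -mulrz_sumr rel // mulr0z.
  apply: (subgroup_sum sT) => j _; apply: (subgroupMz sT).
  by have [|_] := ncP j; first by rewrite -ltnS.
have exj' : exists j, (j <= size l)%N && (e j != 0).
  by have [j jl ej] := exj; exists j; rewrite jl.
(* At the least index with nonzero coefficient, all other terms of the relation lie in
   f^(j0+1)(A). *)
case: (ex_minnP exj') => j0 /andP[jl ej0] minj.
have [Ax nx] := xP j0 jl; have [n0 _] := ncP j0 jl.
pose m := (nc j0).1%:Z * e j0; have m0 : m != 0 by rewrite mulf_neq0 //; lia.
have jl' : (j0 < (size l).+1)%N by [].
rewrite (bigD1 (Ordinal jl')) //= -/m.
have efj := endo_iter eA j0.+1; have sI := img_subgroup sA efj.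
set z := \sum_(_ < _ | _) _; have [a Aa ->] : img (iter j0.+1 f) A z.
  apply: (subgroup_sum sI) => j nj; have jl1 : (j <= size l)%N by rewrite -ltnS.
  have [Ej|nEj] := eqVneq (e j) 0; first by rewrite Ej mulr0 mulr0z; apply: subgroup0.
  have jj : (j0 < j)%N.
    rewrite ltn_neqAle eq_sym; apply/andP; split; first exact: nj.
    by apply: minj; rewrite jl1.
  apply: (subgroupMz sI); apply: (img_iter_add (j := (j - j0.+1)%N) eA).
  by rewrite subnKC //; exists (x j) => //; have [] := xP j jl1.
(* Divisibility of [A] lets the leading coefficient [m] be cancelled modulo torsion. *)
have [b Ab ->] := divisible_mulrz sA dA m0 Aa.
rewrite (endoMz sA efj) // -mulrzDl => /(torsion_mulrz m0) t.
apply: (nx (- b)); first exact: subgroupN.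
by rewrite (endoN sA efj) // opprK.
Qed.

(** * Projections onto the primary components and the two implications *)

Lemma primary_projections (G : zmodType) : strongly_coHopfian G ->
  exists pi : nat -> G -> G, forall p, prime p ->
    [/\ forall x y, pi p (x + y) = pi p x + pi p y, forall x, primary p (pi p x) &
        forall x, primary p x -> pi p x = x].
Proof.
move=> SCH; have [nu nuP] := nu_exists SCH.
have /choice[pi piP] : forall p, exists f : G -> G, prime p ->
    [/\ forall x y, f (x + y) = f x + f y, forall x, primary p (f x) &
        forall x, primary p x -> f x = x].
  move=> p; have [pp|npp] := boolP (prime p); last by exists id.
  by have [f fP] := primary_proj nuP pp; exists f.
by exists pi.
Qed.

Lemma torsion_of_uniform (G : zmodType) : strongly_coHopfian G ->
  uniformly_strongly_coHopfian G -> strongly_coHopfian_on (@torsion G).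
Proof.
move=> SCH [m unif] f ef; exists m; apply/(same_imgP ef).
have [pi piP] := primary_projections SCH.
apply: (@stable_components G pi) => // [p /piP[]//|p /piP[]//|p /piP[]//|p pp].
have [piD pi_primary pi_id] := piP p pp; have efp := endo_primary pp ef.
(* An endomorphism of all of G that agrees with [f] on the [p]-component, so the bound [m] applies
   to it. *)
pose g x := f (pi p x).
have gf k x : primary p x -> iter k g x = iter k f x.
  move=> tx; elim: k => // k IH; rewrite !iterS IH /g pi_id //.
  by have [cl _] := endo_iter efp k; apply: cl.
have eg : endo_on (@whole G) g.
  by apply: endo_whole => x y; rewrite /g piD (endoD efp).
move=> x tx; have [y _ Ey] := proj1 (same_imgP eg m) (unif g eg) x I.
exists (pi p y) => //; rewrite -(gf m) // Ey !iterSr gf //.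
by apply: (endo_closed efp).
Qed.

Lemma uniform_of_torsion (G : zmodType) : strongly_coHopfian G ->
  strongly_coHopfian_on (@torsion G) -> uniformly_strongly_coHopfian G.
Proof.
move=> SCH TSCH; have [nu nuP] := nu_exists SCH.
have [pi piP] := primary_projections SCH.
have piD p (pp : prime p) : forall x y, pi p (x + y) = pi p x + pi p y.
  by have [] := piP p pp.
have pi_primary p (pp : prime p) : forall x, primary p (pi p x).
  by have [] := piP p pp.
have pi_id p (pp : prime p) : forall x, primary p x -> pi p x = x.
  by have [] := piP p pp.
have bound p (pp : prime p) := primary_bounded SCH nuP pp.
have [N HN] := torsion_uniform piD pi_primary pi_id bound TSCH.
have [l Hl] := div_part_rank SCH nuP.
have sW := subgroup_whole G; have sT := subgroup_torsion G.
have sA := @subgroup_div_part G nu; have dA := div_part_divisible nuP.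
(* From left to right: the bounds for G modulo T + A, for T + A modulo T, and for T. *)
exists (N + (size l + N))%N => f ef; apply/(same_imgP ef).
have eT := endo_torsion ef.
have stp p : prime p -> stable_at (@primary G p) f N.
  by move=> pp; apply: HN => //; apply: endo_primary.
have stT := stable_components piD pi_primary pi_id eT stp.
have eA : endo_on (div_part (G := G) nu) f.
  by apply: (endo_on_sub ef) => // x; apply: (div_part_iter ef 1).
have [j jl Hj] := rank_stable sA dA ef eA Hl.
(* The middle term T + A of the filtration. *)
pose S (x : G) := exists2 a : G, div_part nu a & torsion (x - a).
have AS x : div_part nu x -> S x.
  by move=> Ax; exists x; rewrite ?subrr //; apply: subgroup0.
have TS x : torsion x -> S x.
  by move=> Tx; exists 0; rewrite ?subr0 //; apply: subgroup0.
have sS : subgroup S.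
  split; first by apply: TS; apply: subgroup0.
  move=> x y [a Aa Tx] [b Ab Ty]; exists (a - b); first exact: (subgroupB sA).
  rewrite subrACA.
  exact: subgroupB.
have eS : endo_on S f.
  apply: (endo_on_sub ef) => // x [a Aa Tx]; exists (f a); first exact: (endo_closed eA).
  by rewrite -(endoB sW ef) //; apply: (endo_closed eT).
have stS : stable_at S f (j + N).
  apply: (stable_extension sS eS eT TS) stT => x [a Aa Tx].
  have [b Ab Tb] := Hj a Aa; exists b; first exact: AS.
  rewrite -[iter j f x - _](subrKA (iter j f a)) -(endoB sW (endo_iter ef j)) //.
  by apply: (subgroupD sT) => //; have [cl _] := endo_iter eT j; apply: cl.
suff st : stable_at (@whole G) f (N + (j + N)).
  by apply: (img_stable_le _ st); lia.
apply: (stable_extension sW ef eS) stS => // x _.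
by have [y Ay] := image_mod_div_part SCH nuP ef stp x; exists y => //; apply: AS.
Qed.

Theorem mainTheorem12 (G : zmodType) :
  strongly_coHopfian G ->
  (uniformly_strongly_coHopfian G <-> strongly_coHopfian_on (@torsion G)).
Proof.
by move=> SCH; split; [apply: torsion_of_uniform|apply: uniform_of_torsion].
Qed.
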